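(* Let $\mathcal{I} := (I, =_I, \neq_I, <_I)$ be a set with an extensional inequality and relation, and let $(\chi_0, \chi_1)$ be an $\mathcal{I}$-family of sets with an extensional inequality and relation, with members $\mathcal{X}_i := (\chi_0(i), =_{\chi_0(i)}, \neq_{\chi_0(i)}, <_{\chi_0(i)})$, $i \in I$, and transport maps $\chi_{ij} \colon \chi_0(i) \to \chi_0(j)$ for $i =_I j$. Let its Sigma-set be the structure $\sum_{i \in I} \mathcal{X}_i$ whose underlying set $\sum_{i \in I}\chi_0(i)$ consists of the pairs $(i,x)$ with $i \in I$ and $x \in \chi_0(i)$, with $$(i, x) = (j, y) :\Leftrightarrow i =_I j \ \&\ \chi_{ij}(x) =_{\chi_0(j)} y,$$ $$(i, x) \neq (j, y) :\Leftrightarrow i \neq_I j \vee \big(i =_I j \ \&\ \chi_{ij}(x) \neq_{\chi_0(j)} y\big),$$ $$(i, x) < (j, y) :\Leftrightarrow i <_I j \vee \big(i =_I j \ \&\ \chi_{ij}(x) <_{\chi_0(j)} y\big).$$ Then, constructively: (i) $\sum_{i \in I}\mathcal{X}_i$ is a set with an extensional inequality and relation, and its first projection $\mathrm{pr}_1 \colon \sum_{i \in I}\chi_0(i) \to I$, $\mathrm{pr}_1(i,x) := i$, is a strongly extensional function; but $\mathrm{pr}_1$ does not in general preserve the relations (that is, there are a set with an extensional inequality and relation $\mathcal{I} = (I, =_I, \neq_I, <_I)$ and an $\mathcal{I}$-family $(\chi_0, \chi_1)$ of sets with an extensional inequality and relation such that, for the relation $<$ of its Sigma-set, $(i,x) <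 (j,y) \Rightarrow i <_I j$ fails for some $(i,x), (j,y) \in \sum_{i \in I}\chi_0(i)$). (ii) If $\mathcal{I}$ and every $\mathcal{X}_i$ are strong, then $\sum_{i \in I}\mathcal{X}_i$ is strong; if $\mathcal{I}$ and every $\mathcal{X}_i$ are dichotomous, then $\sum_{i \in I}\mathcal{X}_i$ is dichotomous. (iii) If $\mathcal{I}$ and every $\mathcal{X}_i$ are $\exists$-well-founded sets, then $\sum_{i \in I}\mathcal{X}_i$ is an $\exists$-well-founded set.
   Context: Setting: Bishop-style constructive mathematics (intuitionistic reasoning). $\bot_{\mathbb{N}} := (0 =_{\mathbb{N}} 1)$. A set with an extensional inequality and relation is a structure $\mathcal{X} = (X, =_X, \neq_X, <_X)$, where $=_X$ is an equivalence relation (the equality of $X$); $\neq_X$ is a binary relation on $X$ such that $x =_X y \ \&\ x \neq_X y \Rightarrow \bot_{\mathbb{N}}$, $x \neq_X y \Rightarrow y \neq_X x$, and $\neq_X$ is extensional ($x =_X x'$, $y =_X y'$ and $x \neq_X y$ imply $x' \neq_X y'$); and $<_X$ is an extensional binary relation on $X$ ($x =_X x'$, $y =_X y'$ and $x <_X y$ imply $x' <_X y'$). No further property of $<_X$ is assumed. $\mathcal{X}$ is strong if $x <_X x' \Rightarrow x \neq_X x'$ for all $x,x' \in X$, and dichotomous if $x \neq_X x' \Rightarrow (x <_X x' \vee x' <_X x)$ for all $x,x' \in X$. Functions respect equality. A function $f \colon X \to Y$ is strongly extensional if $f(x) \neq_Y f(x') \Rightarrow x \neq_X x'$ for all $x,x'$;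 it preserves the relations if $x <_X x' \Rightarrow f(x) <_Y f(x')$ for all $x,x'$. A formula $P(x)$ on $X$ is extensional if $x =_X y$ and $P(x)$ imply $P(y)$. A set with an extensional inequality and relation $\mathcal{X}$ is an $\exists$-well-founded set if for all extensional formulas $Q(x), P(x)$ on $X$ with $$\forall_{x \in X}\Big(Q(x) \Rightarrow \big[P(x) \vee \exists_{x' \in X}(x' <_X x \ \&\ Q(x'))\big]\Big),$$ one has $\exists_{x \in X} Q(x) \Rightarrow \exists_{x \in X} P(x)$. An $\mathcal{I}$-family of sets with an extensional inequality and relation is a pair $(\chi_0,\chi_1)$, where $\chi_0$ assigns to each $i \in I$ a set with an extensional inequality and relation $\mathcal{X}_i = (\chi_0(i), =_{\chi_0(i)}, \neq_{\chi_0(i)}, <_{\chi_0(i)})$, and $\chi_1$ assigns to each $(i,j) \in I \times I$ with $i =_I j$ a strongly extensional, relation-preserving function $\chi_{ij} \colon \chi_0(i) \to \chi_0(j)$ (the transport map), such that $\chi_{ii} = \mathrm{id}_{\chi_0(i)}$ for every $i \in I$, and $\chi_{ik} = \chi_{jk} \circ \chi_{ij}$ whenever $i =_I j$ and $j =_I k$. *)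

(* Defs.v *)
From Stdlib Require Import RelationClasses.

Set Implicit Arguments.
Unset Strict Implicit.

Declare Scope sir_scope.
Delimit Scope sir_scope with sir.

(* The logic is Rocq's own intuitionistic one: no definition below relies on an
   axiom.  Bishop sets are types with an explicit equality, which is not
   Rocq's [=]. *)

Definition bot_nat : Prop := 0 = 1.

Record relstr : Type := Relstr {
  car :> Type;
  eqr : car -> car -> Prop;
  neqr : car -> car -> Prop;
  ltr : car -> car -> Prop
}.

Arguments eqr {r} _ _.
Arguments neqr {r} _ _.
Arguments ltr {r} _ _.

Notation "x == y" := (eqr x y) (at level 70, no associativity) : sir_scope.
Notation "x =/= y" := (neqr x y) (at level 70, no associativity) : sir_scope.
Notation "x < y" := (ltr x y) (at level 70, no associativity) : sir_scope.
Local Open Scope sir_scope.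

Definition extensional_relation (X : relstr) (R : X -> X -> Prop) : Prop :=
  forall x x' y y' : X, x == x' -> y == y' -> R x y -> R x' y'.

(* "Set with an extensional inequality and relation", as a property of the
   bare data, so that it can be asserted of a Sigma-set. *)
Record is_sir (X : relstr) : Prop := IsSir {
  sir_equiv : Equivalence (@eqr X);
  sir_neq_eq : forall x y : X, x == y -> x =/= y -> bot_nat;
  sir_neq_sym : forall x y : X, x =/= y -> y =/= x;
  sir_neq_ext : extensional_relation (@neqr X);
  sir_lt_ext : extensional_relation (@ltr X)
}.

Record sir : Type := Sir {
  sir_str :> relstr;
  sirP : is_sir sir_str
}.

Definition strong (X : relstr) : Prop :=
  forall x x' : X, x < x' -> x =/= x'.

Definition dichotomous (X : relstr) : Prop :=
  forall x x' : X, x =/= x' -> x < x' \/ x' < x.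

Definition is_function (X Y : relstr) (f : X -> Y) : Prop :=
  forall x x' : X, x == x' -> f x == f x'.

Definition strongly_extensional (X Y : relstr) (f : X -> Y) : Prop :=
  forall x x' : X, f x =/= f x' -> x =/= x'.

Definition preserves_relations (X Y : relstr) (f : X -> Y) : Prop :=
  forall x x' : X, x < x' -> f x < f x'.

Definition extensional_formula (X : relstr) (P : X -> Prop) : Prop :=
  forall x y : X, x == y -> P x -> P y.

Definition exists_well_founded (X : relstr) : Prop :=
  forall Q P : X -> Prop,
    extensional_formula Q -> extensional_formula P ->
    (forall x : X, Q x -> P x \/ exists x' : X, x' < x /\ Q x') ->
    (exists x : X, Q x) -> exists x : X, P x.

(* The transport map takes the proof of [i == j] as an argument.  As [tr_id]
   and [tr_comp] range over all such proofs, transports along two proofs of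
   the same [i == j] are pointwise equal.  Equality of functions is pointwise
   equality in the codomain. *)
Record family (I : sir) : Type := Family {
  fam :> I -> sir;
  tr : forall i j : I, i == j -> fam i -> fam j;
  tr_fun : forall (i j : I) (p : i == j), is_function (tr p);
  tr_sext : forall (i j : I) (p : i == j), strongly_extensional (tr p);
  tr_lt : forall (i j : I) (p : i == j), preserves_relations (tr p);
  tr_id : forall (i : I) (p : i == i) (x : fam i), tr p x == x;
  tr_comp : forall (i j k : I) (p : i == j) (q : j == k) (r : i == k)
    (x : fam i), tr r x == tr q (tr p x)
}.

Arguments tr {I} f {i j} _ _.

(* [exists p : i == j, ...] is the conjunction "i = j and ...", whose second
   component needs the proof of the first in order to mention the transport. *)
Definition Sigma (I : sir) (F : family I) : relstr :=
  {| car := {i : I & F i};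
     eqr := fun u v =>
       exists p : projT1 u == projT1 v, tr F p (projT2 u) == projT2 v;
     neqr := fun u v =>
       projT1 u =/= projT1 v \/
       exists p : projT1 u == projT1 v, tr F p (projT2 u) =/= projT2 v;
     ltr := fun u v =>
       projT1 u < projT1 v \/
       exists p : projT1 u == projT1 v, tr F p (projT2 u) < projT2 v |}.

Definition pr1 (I : sir) (F : family I) (u : Sigma F) : I := projT1 u.

(* Main.v *)
Require Import Defs.
From Stdlib Require Import RelationClasses.
Local Open Scope sir_scope.

(** The equality, inequality and order of a Sigma-set compare [(i, x)] with
    [(j, y)] by moving [x] along a proof of [i == j].  Everything about the
    structure therefore reduces to three facts on transport: it does not depend
    on the proof chosen, transport back along [j == i] inverts it, and it
    preserves [=/=].  The last one holds because strong extensionality reflects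
    [=/=], and reflecting along the inverse transport is preserving along the
    transport itself.

    The first projection loses the order because two comparable points may lie
    over the same index, and the order of the index set may be empty.

    For well-foundedness, a descent in the Sigma-set either lowers the index or
    stays, up to transport, in the same fibre.  Fix [Q] and [P], and let [i] be
    an index over which [Q] has a point.  Well-foundedness of the fibre is
    applied to the target [P (i, x)] or [Q] has a point over some [i' < i]:
    steps inside the fibre are genuine descents there, and a step that lowers
    the index has already reached this enlarged target
    ([fibre_descent]).  The outcome is the descent hypothesis on [I] for the
    formulas [over Q] and [over P], so well-foundedness of [I] concludes.  No
    case is ever decided beforehand: which alternative holds is read off from
    the point that the fibre returns, so the argument is constructive. *)

Section Transport.

Variables (I : sir) (F : family I).

#[local] Instance eqr_equivalence (X : sir) : Equivalence (@eqr X) :=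
  sir_equiv (sirP X).

(** Two proofs of [i == j] are compared by factoring one of them through the
    identity transport at [i]. *)
Lemma tr_irrelevant (i j : I) (p q : i == j) (x : F i) : tr F p x == tr F q x.
Proof.
  transitivity (tr F q (tr F (reflexivity i) x)).
  - apply tr_comp.
  - apply tr_fun, tr_id.
Qed.

Lemma tr_inverse (i j : I) (p : i == j) (q : j == i) (x : F i) :
  tr F q (tr F p x) == x.
Proof.
  transitivity (tr F (reflexivity i) x).
  - symmetry; apply tr_comp.
  - apply tr_id.
Qed.

(** The two ways around a square of indices agree; this is what moves a
    relation between [(i, x)] and [(j, y)] to equal representatives. *)
Lemma tr_square (i j i' j' : I) (p : i == j) (b : j == j') (a : i == i')
    (r : i' == j') (x : F i) :
  tr F b (tr F p x) == tr F r (tr F a x).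
Proof.
  pose proof (transitivity p b) as s.
  transitivity (tr F s x); [symmetry|]; apply tr_comp.
Qed.

(** The inverse transport is strongly extensional, and applied to the two
    images it gives back [x] and [y]. *)
Lemma tr_neq (i j : I) (p : i == j) (x y : F i) :
  x =/= y -> tr F p x =/= tr F p y.
Proof.
  intros xy.
  pose proof (symmetry p) as q.
  apply (tr_sext (p := q)).
  refine (sir_neq_ext (sirP _) _ _ xy); symmetry; apply tr_inverse.
Qed.

Lemma Sigma_equivalence : Equivalence (@eqr (Sigma F)).
Proof.
  split.
  - intros [i x]; exists (reflexivity i); apply tr_id.
  - intros [i x] [j y] [p e]; exists (symmetry p); cbn in *.
    transitivity (tr F (symmetry p) (tr F p x)).
    + apply tr_fun; symmetry; exact e.
    + apply tr_inverse.
  - intros [i x] [j y] [k z] [p e] [q e']; exists (transitivity p q); cbn in *.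
    transitivity (tr F q (tr F p x)); [apply tr_comp|].
    transitivity (tr F q y); [apply tr_fun; exact e | exact e'].
Qed.

(** The inequality and the order of the Sigma-set have the same shape, built
    from an extensional relation on the indices and extensional relations on
    the fibres that are preserved by transport.  Extensionality is proved for
    that shape: transport to the new indices, then replace representatives. *)
Lemma Sigma_relation_extensional (R : I -> I -> Prop)
    (S : forall i : I, F i -> F i -> Prop) :
  extensional_relation (X := I) R ->
  (forall i, extensional_relation (X := F i) (S i)) ->
  (forall (i j : I) (p : i == j) (x y : F i),
      S i x y -> S j (tr F p x) (tr F p y)) ->
  extensional_relation (X := Sigma F)
    (fun u v => R (projT1 u) (projT1 v) \/
       exists p : projT1 u == projT1 v,
         S (projT1 v) (tr F p (projT2 u)) (projT2 v)).
Proof.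
  intros Rext Sext Str [i x] [i' x'] [j y] [j' y'] [a ex] [b ey]; cbn in *.
  intros [ij | [p xy]].
  - left; exact (Rext _ _ _ _ a b ij).
  - assert (r : i' == j').
    { transitivity i; [symmetry; exact a|].
      transitivity j; [exact p | exact b]. }
    right; exists r.
    refine (Sext _ _ _ _ _ _ ey (Str _ _ b _ _ xy)).
    transitivity (tr F r (tr F a x)); [apply tr_square|].
    apply tr_fun; exact ex.
Qed.

Lemma Sigma_is_sir : is_sir (Sigma F).
Proof.
  split.
  - apply Sigma_equivalence.
  - intros [i x] [j y] [p e] [ij | [q xy]]; cbn in *.
    + exact (sir_neq_eq (sirP I) p ij).
    + refine (sir_neq_eq (sirP (F j)) _ xy).
      transitivity (tr F p x); [apply tr_irrelevant | exact e].
  - intros [i x] [j y] [ij | [p xy]]; cbn in *.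
    + left; exact (sir_neq_sym (sirP I) ij).
    + right; exists (symmetry p).
      apply (sir_neq_sym (sirP (F i))).
      refine (sir_neq_ext (sirP (F i)) _ _ (tr_neq _ _ (symmetry p) _ _ xy)).
      * apply tr_inverse.
      * reflexivity.
  - apply (Sigma_relation_extensional _ (fun i => @neqr (F i))).
    + exact (sir_neq_ext (sirP I)).
    + intros i; exact (sir_neq_ext (sirP (F i))).
    + exact tr_neq.
  - apply (Sigma_relation_extensional _ (fun i => @ltr (F i))).
    + exact (sir_lt_ext (sirP I)).
    + intros i; exact (sir_lt_ext (sirP (F i))).
    + intros i j p x y; apply tr_lt.
Qed.

Lemma pr1_is_function : is_function (pr1 (F := F)).
Proof. intros u v [p _]; exact p. Qed.

Lemma pr1_strongly_extensional : strongly_extensional (pr1 (F := F)).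
Proof. intros u v uv; left; exact uv. Qed.

Lemma Sigma_strong :
  strong I -> (forall i : I, strong (F i)) -> strong (Sigma F).
Proof.
  intros sI sF [i x] [j y] [ij | [p xy]].
  - left; exact (sI _ _ ij).
  - right; exists p; exact (sF _ _ _ xy).
Qed.

Lemma Sigma_dichotomous :
  dichotomous I -> (forall i : I, dichotomous (F i)) -> dichotomous (Sigma F).
Proof.
  intros dI dF [i x] [j y] [ij | [p xy]]; cbn in *.
  - destruct (dI _ _ ij); [left | right]; left; assumption.
  - destruct (dF _ _ _ xy) as [lt | gt].
    + left; right; exists p; exact lt.
    + (* The comparison lives over [j]; it is carried back to the fibre of [i]. *)
      right; right; exists (symmetry p).
      refine (sir_lt_ext (sirP (F i)) _ _ (tr_lt (symmetry p) gt)).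
      * reflexivity.
      * apply tr_inverse.
Qed.

Lemma Sigma_eq_tr (i j : I) (p : i == j) (x : F i) :
  @eqr (Sigma F) (existT _ i x) (existT _ j (tr F p x)).
Proof. exists p; cbn; reflexivity. Qed.

Definition over (P : Sigma F -> Prop) (i : I) : Prop :=
  exists x : F i, P (existT _ i x).

Lemma over_extensional (P : Sigma F -> Prop) :
  extensional_formula P -> extensional_formula (over P).
Proof.
  intros Pext i j p [x Px]; exists (tr F p x).
  exact (Pext _ _ (Sigma_eq_tr i j p x) Px).
Qed.

Lemma fibre_formula_extensional (P : Sigma F -> Prop) (i : I) :
  extensional_formula P ->
  extensional_formula (fun x : F i => P (existT _ i x)).
Proof.
  intros Pext x y xy; apply Pext.
  exists (reflexivity i); cbn.
  transitivity x; [apply tr_id | exact xy].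
Qed.

(** Inside one fibre a descent either reaches [P] or leaves the fibre
    downwards.  The second outcome does not mention the point of the fibre, so
    it can be added to the target of the descent without losing
    extensionality. *)
Lemma fibre_descent (Q P : Sigma F -> Prop) (i : I) :
  exists_well_founded (F i) ->
  extensional_formula Q -> extensional_formula P ->
  (forall u, Q u -> P u \/ exists v, v < u /\ Q v) ->
  over Q i -> over P i \/ exists i' : I, i' < i /\ over Q i'.
Proof.
  intros wf Qext Pext step Qi.
  destruct (wf (fun x => Q (existT _ i x))
              (fun x => P (existT _ i x) \/ exists i' : I, i' < i /\ over Q i'))
    as [x [Px | low]].
  - apply fibre_formula_extensional; exact Qext.
  - intros x y xy [Px | low].
    + left; exact (fibre_formula_extensional P i Pext x y xy Px).
    + right; exact low.
  - intros x Qx.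
    destruct (step _ Qx) as [Px | [[j y] [[ji | [p yx]] Qy]]]; cbn in *.
    + left; left; exact Px.
    + left; right; exists j; split; [exact ji | exists y; exact Qy].
    + right; exists (tr F p y); split; [exact yx|].
      exact (Qext _ _ (Sigma_eq_tr j i p y) Qy).
  - exact Qi.
  - left; exists x; exact Px.
  - right; exact low.
Qed.

Lemma Sigma_exists_well_founded :
  exists_well_founded I -> (forall i : I, exists_well_founded (F i)) ->
  exists_well_founded (Sigma F).
Proof.
  intros wfI wfF Q P Qext Pext step [[i x] Qx].
  destruct (wfI (over Q) (over P)) as [j [y Py]].
  - apply over_extensional; exact Qext.
  - apply over_extensional; exact Pext.
  - intros k; apply fibre_descent; auto.
  - exists i, x; exact Qx.
  - exists (existT _ j y); exact Py.
Qed.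

End Transport.

(** One point suffices for the failure of [pr1] to preserve the order: the
    relation [r] is chosen empty on the index set and full on the fibre. *)
Definition point_str (r : Prop) : relstr :=
  {| car := unit;
     eqr := fun _ _ => True;
     neqr := fun _ _ => False;
     ltr := fun _ _ => r |}.

Lemma point_is_sir (r : Prop) : is_sir (point_str r).
Proof.
  split; cbn; try (intros; tauto).
  - split; repeat intro; exact Logic.I.
  - intros x x' y y' _ _ xy; exact xy.
  - intros x x' y y' _ _ xy; exact xy.
Qed.

Definition point (r : Prop) : sir := Sir (point_is_sir r).

Definition constant_family (I X : sir) : family I.
Proof.
  refine (@Family I (fun _ => X) (fun _ _ _ x => x) _ _ _ _ _).
  - intros i j p x y xy; exact xy.
  - intros i j p x y xy; exact xy.
  - intros i j p x y xy; exact xy.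
  - intros i p x; apply (sir_equiv (sirP X)).
  - intros i j k p q r x; apply (sir_equiv (sirP X)).
Defined.

Lemma pr1_not_preserving :
  exists (I : sir) (F : family I) (u v : Sigma F),
    u < v /\ ~ (pr1 u < pr1 v).
Proof.
  exists (point False), (constant_family (point False) (point True)).
  exists (existT _ tt tt), (existT _ tt tt); split.
  - right; exists Logic.I; exact Logic.I.
  - intros lt; exact lt.
Qed.

Theorem proposition6p7 :
  (* (i) *)
  ((forall (I : sir) (F : family I),
      is_sir (Sigma F)
      /\ is_function (pr1 (F := F))
      /\ strongly_extensional (pr1 (F := F)))
   /\ (exists (I : sir) (F : family I) (u v : Sigma F),
         u < v /\ ~ (pr1 u < pr1 v)))
  (* (ii) *)
  /\ (forall (I : sir) (F : family I),
        (strong I -> (forall i : I, strong (F i)) -> strong (Sigma F))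
        /\ (dichotomous I -> (forall i : I, dichotomous (F i)) ->
            dichotomous (Sigma F)))
  (* (iii) *)
  /\ (forall (I : sir) (F : family I),
        exists_well_founded I -> (forall i : I, exists_well_founded (F i)) ->
        exists_well_founded (Sigma F)).
Proof.
  split; [split | split].
  - intros I F; split; [|split].
    + apply Sigma_is_sir.
    + apply pr1_is_function.
    + apply pr1_strongly_extensional.
  - exact pr1_not_preserving.
  - intros I F; split; [apply Sigma_strong | apply Sigma_dichotomous].
  - exact Sigma_exists_well_founded.
Qed.
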